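(* Let $\mathfrak C$ be an $A$-coring, $R$ a firm ring and $\Sigma\in{}_R\mathcal M^{\mathfrak C}$. If $\Sigma$ is $R$-firmly projective, then $\Sigma$ is an $R$-$\mathfrak C$ Galois comodule if and only if $\Sigma$ is an $R$-$\mathfrak C$ comonadic-Galois comodule.
   Context: $A$ is an associative unital ring; $A$-modules are unital. An $A$-coring is an $A$-bimodule $\mathfrak C$ with coassociative, counital $A$-bilinear maps $\Delta:\mathfrak C\to\mathfrak C\otimes_A\mathfrak C$ and $\varepsilon_{\mathfrak C}:\mathfrak C\to A$. A right $\mathfrak C$-comodule is a right $A$-module $M$ with a coassociative counital right $A$-linear coaction $\rho_M(m)=m_{[0]}\otimes_Am_{[1]}\in M\otimes_A\mathfrak C$. Rings $R$ need not be unital. A right (left) $R$-module $M$ is firm if $M\otimes_RR\to M$ (resp. $R\otimes_RM\to M$) given by the action is an isomorphism; $R$ is a firm ring if it is firm as a module over itself. ${}_R\mathcal M^{\mathfrak C}$ consists of right $\mathfrak C$-comodules that are firm left $R$-modules with commuting $A$-action such that the coaction is left $R$-linear (equivalently $R$ acts by $\mathfrak C$-colinear maps). $\Sigma^*=\mathrm{Hom}_A(\Sigma,A)$ and, for $M\in\mathcal M_A$, $\mathrm{Hom}_A(\Sigma,M)$ have right $R$-action $(f\cdot r)(u)=f(ru)$. $\Sigma\otimes_A\Sigma^*$ is a (possibly non-unital) ring with product $(u\otimes_A\varphi)(v\otimes_A\psi)=u\varphi(v)\otimes_A\psi$. $\Sigma$ is $R$-firmly projective if there is a ring morphism $\iota:R\to\Sigma\otimes_A\Sigma^*$,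 $\iota(r)=e_r\otimes_Af_r$ (summation understood), such that $\Sigma$ is a firm left $R$-module for the induced action $r\cdot u=e_rf_r(u)$, this being the given left $R$-action on $\Sigma$. In that case $\Sigma^*\otimes_R\Sigma$ is an $A$-coring (the comatrix coring) with counit $\varphi\otimes_Ru\mapsto\varphi(u)$ and comultiplication $\varphi\otimes_Ru\mapsto\varphi\otimes_Re_r\otimes_Af_r\otimes_Ru^r$, where $r\otimes_Ru^r\in R\otimes_R\Sigma$ is the element corresponding to $u$ (so $u=ru^r$). $\Sigma$ is an $R$-$\mathfrak C$ Galois comodule if it is $R$-firmly projective, with $R$ acting $\mathfrak C$-colinearly, and the coring morphism $\mathsf{can}:\Sigma^*\otimes_R\Sigma\to\mathfrak C$, $\mathsf{can}(f\otimes_Ru)=f(u_{[0]})u_{[1]}$, is an isomorphism. $\Sigma\in{}_R\mathcal M^{\mathfrak C}$ is an $R$-$\mathfrak C$ comonadic-Galois comodule if for all $M\in\mathcal M_A$ the map $\mathsf{can}_M:\mathrm{Hom}_A(\Sigma,M)\otimes_R\Sigma\to M\otimes_A\mathfrak C$, $f\otimes_Ru\mapsto f(u_{[0]})\otimes_Au_{[1]}$, is an isomorphism. *)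

(* Defs.v *)
From HB Require Import structures.
From mathcomp Require Import all_boot ssralg.
From mathcomp Require Import boolp classical_sets.

Set Implicit Arguments.
Unset Strict Implicit.
Unset Printing Implicit Defensive.

Import GRing.Theory.
Local Open Scope ring_scope.
Local Open Scope quotient_scope.

Reserved Notation "r ▷ m" (at level 40, left associativity).
Reserved Notation "m ◁ r" (at level 40, left associativity).
Reserved Notation "M ⊗[ R ] N" (at level 40, R at level 200,
  left associativity, format "M  ⊗[ R ]  N").
Reserved Notation "m ⊗ n" (at level 40, left associativity).

(* Rings that need not be unital, and modules over them. *)
HB.mixin Record Zmodule_isRng R of GRing.Zmodule R := {
  rmul : R -> R -> R;
  rmulA : associative rmul;
  rmulDl : left_distributive rmul +%R;
  rmulDr : right_distributive rmul +%R }.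

#[short(type="rngType")]
HB.structure Definition Rng := {R of Zmodule_isRng R & GRing.Zmodule R}.

(* A unital ring, possibly zero, seen as a ring; unitality of the modules over
   it is stated explicitly where it is needed. *)
#[non_forgetful_inheritance]
HB.instance Definition _ (A : pzRingType) :=
  Zmodule_isRng.Build (GRing.PzRing.sort A) (@mulrA A) (@mulrDl A) (@mulrDr A).
Coercion PzRing_sort__canonical__Defs_Rng : GRing.PzRing.type >-> Rng.type.

HB.mixin Record Zmodule_isLeftModule (R : rngType) M of GRing.Zmodule M := {
  lact : R -> M -> M;
  lactA : forall r s m, lact r (lact s m) = lact (rmul r s) m;
  lactDl : forall r s m, lact (r + s) m = lact r m + lact s m;
  lactDr : forall r m n, lact r (m + n) = lact r m + lact r n }.

#[short(type="leftModType")]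
HB.structure Definition LeftModule (R : rngType) :=
  {M of Zmodule_isLeftModule R M & GRing.Zmodule M}.

HB.mixin Record Zmodule_isRightModule (R : rngType) M of GRing.Zmodule M := {
  ract : M -> R -> M;
  ractA : forall m r s, ract (ract m r) s = ract m (rmul r s);
  ractDl : forall m n r, ract (m + n) r = ract m r + ract n r;
  ractDr : forall m r s, ract m (r + s) = ract m r + ract m s }.

#[short(type="rightModType")]
HB.structure Definition RightModule (R : rngType) :=
  {M of Zmodule_isRightModule R M & GRing.Zmodule M}.

Notation "r ▷ m" := (lact r m) : ring_scope.
Notation "m ◁ r" := (ract m r) : ring_scope.

HB.mixin Record isBimodule (R S : rngType) M
    of LeftModule R M & RightModule S M := {
  lractA : forall (r : R) (m : M) (s : S), (r ▷ m) ◁ s = r ▷ (m ◁ s) }.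

#[short(type="bimodType")]
HB.structure Definition Bimodule (R S : rngType) :=
  {M of isBimodule R S M & LeftModule R M & RightModule S M}.

Definition regular (R : rngType) : Type := R.
Notation "R ^reg" := (regular R) (at level 2, format "R ^reg") : type_scope.

Section Regular.
Variable R : rngType.
HB.instance Definition _ := GRing.Zmodule.on R^reg.
HB.instance Definition _ := Zmodule_isLeftModule.Build R R^reg
  (fun r s m => @rmulA R r s m) (@rmulDl R) (@rmulDr R).
HB.instance Definition _ := Zmodule_isRightModule.Build R R^reg
  (fun m r s => esym (@rmulA R m r s)) (@rmulDl R) (@rmulDr R).
HB.instance Definition _ := isBimodule.Build R R R^reg
  (fun r m s => esym (@rmulA R r m s)).
End Regular.

(* The tensor product over R, as the abelian group generated by pairs subject to
   the relations below. A formal sum is a list of pairs; no formal negatives are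
   needed, since (- m, n) is the opposite of (m, n). *)
Section Tensor.
Variables (R : rngType) (M : rightModType R) (N : leftModType R).

Inductive tensor_eq : seq (M * N) -> seq (M * N) -> Prop :=
| TensorRefl s : tensor_eq s s
| TensorSym s t : tensor_eq s t -> tensor_eq t s
| TensorTrans s t u : tensor_eq s t -> tensor_eq t u -> tensor_eq s u
| TensorCat s s' t t' :
    tensor_eq s s' -> tensor_eq t t' -> tensor_eq (s ++ t) (s' ++ t')
| TensorC s t : tensor_eq (s ++ t) (t ++ s)
| Tensor0 n : tensor_eq [:: (0, n)] [::]
| TensorDl m m' n : tensor_eq [:: (m + m', n)] [:: (m, n); (m', n)]
| TensorDr m n n' : tensor_eq [:: (m, n + n')] [:: (m, n); (m, n')]
| TensorA m r n : tensor_eq [:: (m ◁ r, n)] [:: (m, r ▷ n)].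

Definition tensor_eqb (s t : seq (M * N)) := `[< tensor_eq s t >].

Lemma tensor_eqb_refl : reflexive tensor_eqb.
Proof. by move=> s; apply/asboolP; exact: TensorRefl. Qed.

Lemma tensor_eqb_sym : symmetric tensor_eqb.
Proof. by move=> s t; apply/asboolP/asboolP; exact: TensorSym. Qed.

Lemma tensor_eqb_trans : transitive tensor_eqb.
Proof.
by move=> t s u /asboolP st /asboolP tu; apply/asboolP; exact: TensorTrans tu.
Qed.

Canonical tensor_equiv :=
  EquivRel tensor_eqb tensor_eqb_refl tensor_eqb_sym tensor_eqb_trans.

Variant tensor : Type := Tensor of {eq_quot tensor_equiv}.

Definition tensor_quot (t : tensor) := let: Tensor q := t in q.

HB.instance Definition _ := [isNew for tensor_quot].
HB.instance Definition _ := [Choice of tensor by <:].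

Definition tensor_class (s : seq (M * N)) : tensor :=
  Tensor (\pi_{eq_quot tensor_equiv} s).
Definition tensor_repr (t : tensor) : seq (M * N) := repr (tensor_quot t).
Definition tens (m : M) (n : N) : tensor := tensor_class [:: (m, n)].

Lemma tensor_classP s t : tensor_class s = tensor_class t <-> tensor_eq s t.
Proof.
split=> [[] /eqmodP/asboolP //|/asboolP st].
by congr Tensor; exact/eqmodP.
Qed.

Lemma tensor_reprK (t : tensor) : tensor_class (tensor_repr t) = t.
Proof. by case: t => q; rewrite /tensor_class reprK. Qed.

Definition tensor_zero : tensor := tensor_class [::].
Definition tensor_add (s t : tensor) : tensor :=
  tensor_class (tensor_repr s ++ tensor_repr t).
Definition tensor_opp (t : tensor) : tensor :=
  tensor_class [seq (- p.1, p.2) | p <- tensor_repr t].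

Lemma tensor_classD s t :
  tensor_add (tensor_class s) (tensor_class t) = tensor_class (s ++ t).
Proof.
by apply/tensor_classP/TensorCat; apply/tensor_classP; rewrite tensor_reprK.
Qed.

Lemma tensor_addA : associative tensor_add.
Proof.
move=> s t u; rewrite -(tensor_reprK s) -(tensor_reprK t) -(tensor_reprK u).
by rewrite !tensor_classD catA.
Qed.

Lemma tensor_addC : commutative tensor_add.
Proof. by move=> s t; apply/tensor_classP/TensorC. Qed.

Lemma tensor_add0 : left_id tensor_zero tensor_add.
Proof. by move=> t; rewrite -(tensor_reprK t) tensor_classD. Qed.

Lemma tensor_addN : left_inverse tensor_zero tensor_opp tensor_add.
Proof.
move=> t; rewrite -{2}(tensor_reprK t) tensor_classD; apply/tensor_classP.
elim: (tensor_repr t) => [|[m n] s IHs] /=; first exact: TensorRefl.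
set u := [seq (- p.1, p.2) | p <- s] in IHs *.
have swap : tensor_eq ([:: (- m, n)] ++ (u ++ [:: (m, n)]) ++ s)
                      (([:: (- m, n)] ++ [:: (m, n)]) ++ (u ++ s)).
  rewrite -!catA; apply: (TensorCat (TensorRefl _)); rewrite !catA.
  by apply: TensorCat (TensorRefl _); exact: TensorC.
have inv : tensor_eq ([:: (- m, n)] ++ [:: (m, n)]) [::].
  apply: TensorTrans (TensorSym (TensorDl _ _ _)) _.
  by rewrite addNr; exact: Tensor0.
have := TensorTrans swap (TensorCat inv IHs).
by rewrite /= -catA.
Qed.

HB.instance Definition _ := GRing.isZmodule.Build tensor
  tensor_addA tensor_addC tensor_add0 tensor_addN.

Lemma tensDl m m' n : tens (m + m') n = tens m n + tens m' n.
Proof. by rewrite [RHS]tensor_classD; exact/tensor_classP/TensorDl. Qed.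

Lemma tensDr m n n' : tens m (n + n') = tens m n + tens m n'.
Proof. by rewrite [RHS]tensor_classD; exact/tensor_classP/TensorDr. Qed.

Lemma tensA m r n : tens (m ◁ r) n = tens m (r ▷ n).
Proof. exact/tensor_classP/TensorA. Qed.

Lemma tensor_ind (P : tensor -> Prop) :
  P 0 -> (forall m n, P (tens m n)) -> (forall s t, P s -> P t -> P (s + t)) ->
  forall t, P t.
Proof.
move=> P0 P1 PD t; rewrite -(tensor_reprK t).
elim: (tensor_repr t) => [|[m n] s IHs]; first exact: P0.
by rewrite -cat1s -tensor_classD; apply: PD; first exact: P1.
Qed.

(* The additive map induced by f; it is meaningful only when f is balanced, in
   which case [tlift_tens] and [tliftD] characterize it. *)
Definition tlift (G : zmodType) (f : M -> N -> G) (t : tensor) : G :=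
  \sum_(p <- tensor_repr t) f p.1 p.2.

Record balanced (G : zmodType) (f : M -> N -> G) : Prop := Balanced {
  balancedDl : forall m m' n, f (m + m') n = f m n + f m' n;
  balancedDr : forall m n n', f m (n + n') = f m n + f m n';
  balancedA : forall m r n, f (m ◁ r) n = f m (r ▷ n) }.

Section Lift.
Variables (G : zmodType) (f : M -> N -> G).
Hypothesis bf : balanced f.

Lemma tlift_class s : tlift f (tensor_class s) = \sum_(p <- s) f p.1 p.2.
Proof.
have: tensor_eq (tensor_repr (tensor_class s)) s.
  by apply/tensor_classP; rewrite tensor_reprK.
rewrite /tlift; move: (tensor_repr _) => s'; elim=> {s s'} //.
- by move=> s t u _ -> _ ->.
- by move=> s s' t t' _ IHs _ IHt; rewrite !big_cat /= IHs IHt.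
- by move=> s t; rewrite !big_cat /= addrC.
- move=> n; rewrite big_seq1 big_nil /=; apply: (addrI (f 0 n)).
  by rewrite -(balancedDl bf) !addr0.
- by move=> m m' n; rewrite !big_cons !big_nil !addr0 (balancedDl bf).
- by move=> m n n'; rewrite !big_cons !big_nil !addr0 (balancedDr bf).
- by move=> m r n; rewrite !big_seq1 (balancedA bf).
Qed.

Lemma tlift_tens m n : tlift f (tens m n) = f m n.
Proof. by rewrite tlift_class big_seq1. Qed.

Lemma tliftD : {morph tlift f : s t / s + t}.
Proof.
move=> s t; rewrite -(tensor_reprK s) -(tensor_reprK t) [X in tlift _ X]tensor_classD.
by rewrite !tlift_class big_cat.
Qed.
End Lift.

End Tensor.

Arguments tens {R M N} m n.
Arguments tlift {R M N G} f t.
Notation "M ⊗[ R ] N" := (@tensor R M N) : type_scope.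
Notation "m ⊗ n" := (tens m n) : ring_scope.

Lemma add_morph0 (U V : zmodType) (f : U -> V) :
  {morph f : x y / x + y} -> f 0 = 0.
Proof. by move=> fD; apply: (addrI (f 0)); rewrite -fD !addr0. Qed.

Lemma tensor_ext (R : rngType) (M : rightModType R) (N : leftModType R)
    (G : zmodType) (f g : M ⊗[R] N -> G) :
  {morph f : s t / s + t} -> {morph g : s t / s + t} ->
  (forall m n, f (m ⊗ n) = g (m ⊗ n)) -> f =1 g.
Proof.
move=> fD gD fg; elim/tensor_ind => [|//|s t fgs fgt].
  by rewrite !add_morph0.
by rewrite fD gD fgs fgt.
Qed.

Section TensorLeft.
Variables (R S : rngType) (M : bimodType R S) (N : leftModType S).

Lemma tensor_lact_balanced (r : R) :
  balanced (fun (m : M) (n : N) => (r ▷ m) ⊗ n : M ⊗[S] N).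
Proof.
by split=> *; rewrite ?lactDr ?tensDl ?tensDr // -lractA tensA.
Qed.

Definition tensor_lact (r : R) : M ⊗[S] N -> M ⊗[S] N :=
  tlift (fun m n => (r ▷ m) ⊗ n).

Lemma tensor_lact_tens r m n : tensor_lact r (m ⊗ n) = (r ▷ m) ⊗ n.
Proof. by rewrite /tensor_lact (tlift_tens (tensor_lact_balanced r)). Qed.

Lemma tensor_lactDr r : {morph tensor_lact r : s t / s + t}.
Proof. exact: tliftD (tensor_lact_balanced r). Qed.

Lemma tensor_lactA r s t :
  tensor_lact r (tensor_lact s t) = tensor_lact (rmul r s) t.
Proof.
move: t; apply: tensor_ext => [s' t|s' t|m n]; rewrite ?tensor_lactDr //.
by rewrite !tensor_lact_tens lactA.
Qed.

Lemma tensor_lactDl r s t :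
  tensor_lact (r + s) t = tensor_lact r t + tensor_lact s t.
Proof.
move: t; apply: tensor_ext => [s' t|s' t|m n]; rewrite ?tensor_lactDr //.
  by rewrite addrACA.
by rewrite !tensor_lact_tens lactDl tensDl.
Qed.

HB.instance Definition _ := Zmodule_isLeftModule.Build R (M ⊗[S] N)
  tensor_lactA tensor_lactDl tensor_lactDr.

Lemma lact_tens (r : R) (m : M) (n : N) :
  r ▷ (m ⊗ n) = (r ▷ m) ⊗ n :> M ⊗[S] N.
Proof. exact: tensor_lact_tens. Qed.
End TensorLeft.

Section TensorRight.
Variables (S T : rngType) (M : rightModType S) (N : bimodType S T).

Lemma tensor_ract_balanced (r : T) :
  balanced (fun (m : M) (n : N) => m ⊗ (n ◁ r) : M ⊗[S] N).
Proof.
by split=> *; rewrite ?ractDl ?tensDl ?tensDr // tensA lractA.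
Qed.

Definition tensor_ract (t : M ⊗[S] N) (r : T) : M ⊗[S] N :=
  tlift (fun m n => m ⊗ (n ◁ r)) t.

Lemma tensor_ract_tens m n r : tensor_ract (m ⊗ n) r = m ⊗ (n ◁ r).
Proof. by rewrite /tensor_ract (tlift_tens (tensor_ract_balanced r)). Qed.

Lemma tensor_ractDl s t r :
  tensor_ract (s + t) r = tensor_ract s r + tensor_ract t r.
Proof. exact: (tliftD (tensor_ract_balanced r)). Qed.

Lemma tensor_ractA t r s :
  tensor_ract (tensor_ract t r) s = tensor_ract t (rmul r s).
Proof.
move: t; apply: tensor_ext => [s' t|s' t|m n]; rewrite ?tensor_ractDl //.
by rewrite !tensor_ract_tens ractA.
Qed.

Lemma tensor_ractDr t r s :
  tensor_ract t (r + s) = tensor_ract t r + tensor_ract t s.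
Proof.
move: t; apply: tensor_ext => [s' t|s' t|m n]; rewrite ?tensor_ractDl //.
  by rewrite addrACA.
by rewrite !tensor_ract_tens ractDr tensDr.
Qed.

HB.instance Definition _ := Zmodule_isRightModule.Build T (M ⊗[S] N)
  tensor_ractA tensor_ractDl tensor_ractDr.

Lemma ract_tens (m : M) (n : N) (r : T) :
  (m ⊗ n : M ⊗[S] N) ◁ r = m ⊗ (n ◁ r).
Proof. exact: tensor_ract_tens. Qed.
End TensorRight.

Section TensorBimodule.
Variables (R S T : rngType) (M : bimodType R S) (N : bimodType S T).

Lemma tensor_lractA (r : R) (t : M ⊗[S] N) (s : T) :
  (r ▷ t) ◁ s = r ▷ (t ◁ s).
Proof.
move: t; apply: tensor_ext => [s' t|s' t|m n]; rewrite ?(lactDr, ractDl) //.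
by rewrite !(lact_tens, ract_tens).
Qed.

HB.instance Definition _ := isBimodule.Build R T (M ⊗[S] N) tensor_lractA.
End TensorBimodule.

Record left_linear (R : rngType) (U V : leftModType R) (f : U -> V) : Prop :=
  LeftLinear {
    left_linearD : {morph f : u v / u + v};
    left_linearZ : forall r u, f (r ▷ u) = r ▷ f u }.

Record right_linear (R : rngType) (U V : rightModType R) (f : U -> V) : Prop :=
  RightLinear {
    right_linearD : {morph f : u v / u + v};
    right_linearZ : forall u r, f (u ◁ r) = f u ◁ r }.

Section TensorMap.
Variables (R : rngType) (M M' : rightModType R) (N N' : leftModType R).

Definition tmap (f : M -> M') (g : N -> N') : M ⊗[R] N -> M' ⊗[R] N' :=
  tlift (fun m n => f m ⊗ g n).

Variables (f : M -> M') (g : N -> N').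
Hypotheses (rf : right_linear f) (lg : left_linear g).

Lemma tmap_balanced : balanced (fun m n => f m ⊗ g n : M' ⊗[R] N').
Proof.
case: rf lg => [fD fZ] [gD gZ]; split=> *; rewrite ?fD ?gD ?tensDl ?tensDr //.
by rewrite fZ gZ tensA.
Qed.

Lemma tmap_tens m n : tmap f g (m ⊗ n) = f m ⊗ g n.
Proof. exact: tlift_tens tmap_balanced m n. Qed.

Lemma tmapD : {morph tmap f g : s t / s + t}.
Proof. exact: tliftD tmap_balanced. Qed.
End TensorMap.

Lemma id_left_linear (R : rngType) (M : leftModType R) : left_linear (@id M).
Proof. by []. Qed.

Lemma id_right_linear (R : rngType) (M : rightModType R) :
  right_linear (@id M).
Proof. by []. Qed.

Section TensorAssoc.
Variables (R S : rngType).
Variables (M : rightModType R) (N : bimodType R S) (P : leftModType S).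

Definition tassoc : (M ⊗[R] N) ⊗[S] P -> M ⊗[R] (N ⊗[S] P) :=
  tlift (fun t p => tlift (fun m n => m ⊗ (n ⊗ p)) t).

Lemma tassoc_inner_balanced p :
  balanced (fun (m : M) (n : N) => m ⊗ (n ⊗ p : N ⊗[S] P) : M ⊗[R] _).
Proof.
by split=> *; rewrite ?tensDl ?tensDr // -lact_tens tensA.
Qed.

Lemma tassoc_balanced :
  balanced (fun (t : M ⊗[R] N) (p : P) =>
              tlift (fun m n => m ⊗ (n ⊗ p : N ⊗[S] P)) t : M ⊗[R] _).
Proof.
have inner := tassoc_inner_balanced; have innerD p := tliftD (inner p).
split=> [s t p|t p q|t r p]; first exact: innerD.
  move: t; apply: tensor_ext => [s t|s t|m n]; rewrite ?innerD //.
    by rewrite addrACA.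
  by rewrite !(tlift_tens (inner _)) !tensDr.
move: t; apply: tensor_ext => [s t|s t|m n]; rewrite ?ractDl ?innerD //.
by rewrite ract_tens !(tlift_tens (inner _)) tensA.
Qed.

Lemma tassocD : {morph tassoc : s t / s + t}.
Proof. exact: tliftD tassoc_balanced. Qed.

Lemma tassoc_tens m n p : tassoc ((m ⊗ n) ⊗ p) = m ⊗ (n ⊗ p).
Proof.
rewrite /tassoc (tlift_tens tassoc_balanced).
exact: (tlift_tens (tassoc_inner_balanced p)).
Qed.
End TensorAssoc.

Section RightHom.
Variables (A : rngType) (U V : rightModType A).

Record rhom := RightHom {
  rhom_fun :> U -> V;
  rhomD : {morph rhom_fun : u v / u + v};
  rhom_ract : forall u a, rhom_fun (u ◁ a) = rhom_fun u ◁ a }.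

Lemma rhomP (f g : rhom) : f =1 g -> f = g.
Proof.
case: f g => [f fD fA] [g gD gA] /= /funext fg; subst g.
by congr RightHom; exact: Prop_irrelevance.
Qed.

HB.instance Definition _ := gen_eqMixin rhom.
HB.instance Definition _ := gen_choiceMixin rhom.

Lemma ract0m (W : rightModType A) (a : A) : 0 ◁ a = 0 :> W.
Proof. by apply: (@add_morph0 _ _ (fun w : W => w ◁ a)) => x y; exact: ractDl. Qed.

Lemma ractN (W : rightModType A) (w : W) (a : A) : - w ◁ a = - (w ◁ a).
Proof. by apply: (addrI (w ◁ a)); rewrite -ractDl !subrr ract0m. Qed.

Program Definition rhom_zero := @RightHom (fun=> 0) _ _.
Next Obligation. by move=> u v; rewrite addr0. Qed.
Next Obligation. by rewrite ract0m. Qed.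

Program Definition rhom_add (f g : rhom) := @RightHom (fun u => f u + g u) _ _.
Next Obligation. by move=> u v; rewrite !rhomD addrACA. Qed.
Next Obligation. by rewrite !rhom_ract ractDl. Qed.

Program Definition rhom_opp (f : rhom) := @RightHom (fun u => - f u) _ _.
Next Obligation. by move=> u v; rewrite rhomD opprD. Qed.
Next Obligation. by rewrite rhom_ract ractN. Qed.

Lemma rhom_addA : associative rhom_add.
Proof. by move=> f g h; apply: rhomP => u /=; rewrite addrA. Qed.
Lemma rhom_addC : commutative rhom_add.
Proof. by move=> f g; apply: rhomP => u /=; rewrite addrC. Qed.
Lemma rhom_add0 : left_id rhom_zero rhom_add.
Proof. by move=> f; apply: rhomP => u /=; rewrite add0r. Qed.
Lemma rhom_addN : left_inverse rhom_zero rhom_opp rhom_add.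
Proof. by move=> f; apply: rhomP => u /=; rewrite addNr. Qed.

HB.instance Definition _ := GRing.isZmodule.Build rhom
  rhom_addA rhom_addC rhom_add0 rhom_addN.
End RightHom.

Notation "'Hom_[ A ] ( U , V )" := (@rhom A U V) : type_scope.

Section RightHomRight.
Variables (R A : rngType) (U : bimodType R A) (V : rightModType A).

Program Definition rhom_ractr (f : 'Hom_[A](U, V)) (r : R) : 'Hom_[A](U, V) :=
  @RightHom A U V (fun u => f (r ▷ u)) _ _.
Next Obligation. by move=> u v; rewrite lactDr rhomD. Qed.
Next Obligation. by rewrite -lractA rhom_ract. Qed.

Lemma rhom_ractrA f r s : rhom_ractr (rhom_ractr f r) s = rhom_ractr f (rmul r s).
Proof. by apply: rhomP => u /=; rewrite lactA. Qed.
Lemma rhom_ractrDl f g r : rhom_ractr (f + g) r = rhom_ractr f r + rhom_ractr g r.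
Proof. exact: rhomP. Qed.
Lemma rhom_ractrDr f r s : rhom_ractr f (r + s) = rhom_ractr f r + rhom_ractr f s.
Proof. by apply: rhomP => u /=; rewrite lactDl rhomD. Qed.

HB.instance Definition _ := Zmodule_isRightModule.Build R 'Hom_[A](U, V)
  rhom_ractrA rhom_ractrDl rhom_ractrDr.
End RightHomRight.

Section RightHomLeft.
Variables (T A : rngType) (U : rightModType A) (V : bimodType T A).

Program Definition rhom_lactr (t : T) (f : 'Hom_[A](U, V)) : 'Hom_[A](U, V) :=
  @RightHom A U V (fun u => t ▷ f u) _ _.
Next Obligation. by move=> u v; rewrite rhomD lactDr. Qed.
Next Obligation. by rewrite rhom_ract lractA. Qed.

Lemma rhom_lactrA r s f : rhom_lactr r (rhom_lactr s f) = rhom_lactr (rmul r s) f.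
Proof. by apply: rhomP => u /=; rewrite lactA. Qed.
Lemma rhom_lactrDl r s f : rhom_lactr (r + s) f = rhom_lactr r f + rhom_lactr s f.
Proof. by apply: rhomP => u /=; rewrite lactDl. Qed.
Lemma rhom_lactrDr r f g : rhom_lactr r (f + g) = rhom_lactr r f + rhom_lactr r g.
Proof. by apply: rhomP => u /=; rewrite lactDr. Qed.

HB.instance Definition _ := Zmodule_isLeftModule.Build T 'Hom_[A](U, V)
  rhom_lactrA rhom_lactrDl rhom_lactrDr.
End RightHomLeft.

Section RightHomBimodule.
Variables (R T A : rngType) (U : bimodType R A) (V : bimodType T A).

Lemma rhom_lractA (t : T) (f : 'Hom_[A](U, V)) (r : R) :
  (t ▷ f) ◁ r = t ▷ (f ◁ r).
Proof. exact: rhomP. Qed.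

HB.instance Definition _ := isBimodule.Build T R 'Hom_[A](U, V) rhom_lractA.
End RightHomBimodule.


(* The ring U ⊗ U^* and its evaluation action on U. *)
Section FiniteRank.
Variables (A : pzRingType) (U : rightModType A).
Notation finite_rank := (U ⊗[A] 'Hom_[A](U, A^reg)).

Definition finite_rank_eval (t : finite_rank) (v : U) : U :=
  tlift (fun u (f : 'Hom_[A](U, A^reg)) => u ◁ f v) t.

Lemma finite_rank_eval_balanced (v : U) :
  balanced (fun (u : U) (f : 'Hom_[A](U, A^reg)) => u ◁ f v).
Proof.
split=> [u u' f|u f g|u a f]; [exact: ractDl|exact: ractDr|exact: ractA].
Qed.

Lemma finite_rank_evalE u (f : 'Hom_[A](U, A^reg)) v :
  finite_rank_eval (u ⊗ f) v = u ◁ f v.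
Proof. exact: tlift_tens (finite_rank_eval_balanced v) u f. Qed.

Lemma finite_rank_evalDl v : {morph finite_rank_eval^~ v : s t / s + t}.
Proof. exact: tliftD (finite_rank_eval_balanced v). Qed.

Lemma finite_rank_evalDr t : {morph finite_rank_eval t : u v / u + v}.
Proof.
move=> v w; move: t.
apply: tensor_ext => [s t|s t|u f]; rewrite ?finite_rank_evalDl //.
  by rewrite addrACA.
by rewrite !finite_rank_evalE rhomD ractDr.
Qed.

Lemma finite_rank_evalZ t v a :
  finite_rank_eval t (v ◁ a) = finite_rank_eval t v ◁ a.
Proof.
move: t; apply: tensor_ext => [s t|s t|u f];
  rewrite ?finite_rank_evalDl ?ractDl //.
by rewrite !finite_rank_evalE rhom_ract ractA.
Qed.

Definition finite_rank_mul (s t : finite_rank) : finite_rank :=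
  tlift (fun u (f : 'Hom_[A](U, A^reg)) =>
    tlift (fun v g => (u ◁ f v) ⊗ g) t) s.

Lemma finite_rank_mul_inner_balanced u (f : 'Hom_[A](U, A^reg)) :
  balanced (fun (v : U) (g : 'Hom_[A](U, A^reg)) => (u ◁ f v) ⊗ g : finite_rank).
Proof.
split=> [v v' g|v g h|v a g]; rewrite ?rhomD ?ractDr ?tensDl ?tensDr //.
by rewrite rhom_ract -ractA tensA.
Qed.

Lemma finite_rank_mul_balanced t :
  balanced (fun (u : U) (f : 'Hom_[A](U, A^reg)) =>
    tlift (fun v g => (u ◁ f v) ⊗ g) t : finite_rank).
Proof.
have inner := finite_rank_mul_inner_balanced.
have innerD u f := tliftD (inner u f).
split=> [u u' f|u f g|u a f]; move: t;
  apply: tensor_ext => [s t|s t|v h]; rewrite ?innerD 1?addrACA //;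
  rewrite !(tlift_tens (inner _ _)).
- by rewrite ractDl tensDl.
- by rewrite ractDr tensDl.
- by rewrite ractA.
Qed.

Lemma finite_rank_mulE u (f : 'Hom_[A](U, A^reg)) v g :
  finite_rank_mul (u ⊗ f) (v ⊗ g) = (u ◁ f v) ⊗ g.
Proof.
rewrite /finite_rank_mul (tlift_tens (finite_rank_mul_balanced _)).
exact: (tlift_tens (finite_rank_mul_inner_balanced u f)).
Qed.

Lemma finite_rank_mulDl : left_distributive finite_rank_mul +%R.
Proof. by move=> s s' t; exact: (tliftD (finite_rank_mul_balanced t)). Qed.

Lemma finite_rank_mulDr : right_distributive finite_rank_mul +%R.
Proof.
move=> s t t'; move: s; apply: tensor_ext => [s s'|s s'|u f];
  rewrite ?finite_rank_mulDl //; first by rewrite addrACA.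
rewrite /finite_rank_mul !(tlift_tens (finite_rank_mul_balanced _)).
exact: (tliftD (finite_rank_mul_inner_balanced u f)).
Qed.

Lemma finite_rank_mul_tens t u (f : 'Hom_[A](U, A^reg)) :
  finite_rank_mul t (u ⊗ f) = finite_rank_eval t u ⊗ f.
Proof.
move: t; apply: tensor_ext => [s t|s t|v g].
- exact: finite_rank_mulDl.
- by rewrite finite_rank_evalDl tensDl.
- by rewrite finite_rank_mulE finite_rank_evalE.
Qed.

Lemma finite_rank_evalM s t u :
  finite_rank_eval (finite_rank_mul s t) u =
    finite_rank_eval s (finite_rank_eval t u).
Proof.
move: t; apply: tensor_ext => [t t'|t t'|v f].
- by rewrite finite_rank_mulDr finite_rank_evalDl.
- by rewrite finite_rank_evalDl finite_rank_evalDr.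
- by rewrite finite_rank_mul_tens !finite_rank_evalE finite_rank_evalZ.
Qed.

Lemma finite_rank_mulA : associative finite_rank_mul.
Proof.
move=> s t w; move: w; apply: tensor_ext => [w w'|w w'|v f];
  rewrite ?finite_rank_mulDr //.
by rewrite !finite_rank_mul_tens finite_rank_evalM.
Qed.

HB.instance Definition _ := Zmodule_isRng.Build finite_rank
  finite_rank_mulA finite_rank_mulDl finite_rank_mulDr.
End FiniteRank.

Section Firm.
Variables (R : rngType) (M : leftModType R).

Definition firm_act : R^reg ⊗[R] M -> M := tlift (fun (r : R^reg) (m : M) => r ▷ m).

Definition left_firm := bijective firm_act.

(* When M is firm, the inverse of firm_act: m |-> r ⊗ m^r. *)
Definition firm_split (m : M) : R^reg ⊗[R] M :=
  xget 0 [set t | firm_act t = m]%classic.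

Lemma firm_act_balanced : balanced (fun (r : R^reg) (m : M) => r ▷ m).
Proof.
by split=> [r s m|r m n|r s m]; [exact: lactDl|exact: lactDr|rewrite lactA].
Qed.

Lemma firm_act_tens (r : R^reg) m : firm_act (r ⊗ m) = r ▷ m.
Proof. exact: tlift_tens firm_act_balanced r m. Qed.

Lemma firm_actD : {morph firm_act : s t / s + t}.
Proof. exact: tliftD firm_act_balanced. Qed.

Hypothesis firmM : left_firm.

Lemma firm_splitK : cancel firm_split firm_act.
Proof.
move=> m; have [g _ gK] := firmM.
by rewrite /firm_split; case: xgetP => [t _ //|/(_ (g m))]; rewrite /= gK.
Qed.

Lemma firm_actK : cancel firm_act firm_split.
Proof. by move=> t; apply: (bij_inj firmM); rewrite firm_splitK. Qed.

Lemma firm_splitD : {morph firm_split : m n / m + n}.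
Proof.
by move=> m n; apply: (bij_inj firmM); rewrite firm_actD !firm_splitK.
Qed.

Lemma firm_split_act (r : R) m : firm_split (r ▷ m) = (r : R^reg) ⊗ m.
Proof. by rewrite -firm_act_tens firm_actK. Qed.

Lemma firm_ext (G : zmodType) (f g : M -> G) :
  {morph f : m n / m + n} -> {morph g : m n / m + n} ->
  (forall r m, f (r ▷ m) = g (r ▷ m)) -> f =1 g.
Proof.
move=> fD gD fg m; rewrite -(firm_splitK m).
move: (firm_split m); apply: tensor_ext => [s t|s t|r n].
- by rewrite firm_actD fD.
- by rewrite firm_actD gD.
- by rewrite firm_act_tens.
Qed.
End Firm.

(* On R^reg the map is the multiplication R ⊗ R -> R, so that left and right
   firmness of R over itself are the same condition. *)
Definition firm_ring (R : rngType) : Prop := left_firm R^reg.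

HB.mixin Record Bimodule_isCoring (A : pzRingType) C of Bimodule A A C := {
  coring_unitl : forall c : C, (1 : A) ▷ c = c;
  coring_unitr : forall c : C, c ◁ (1 : A) = c;
  comul : C -> C ⊗[A] C;
  counit : C -> A^reg;
  comul_left : left_linear comul;
  comul_right : right_linear comul;
  counit_left : left_linear counit;
  counit_right : right_linear counit;
  comulA : forall c, tassoc (tmap comul id (comul c)) = tmap id comul (comul c);
  comul_counitl : forall c, tlift (fun c1 c2 => counit c1 ▷ c2) (comul c) = c;
  comul_counitr : forall c, tlift (fun c1 c2 => c1 ◁ counit c2) (comul c) = c }.

#[short(type="coringType")]
HB.structure Definition Coring (A : pzRingType) :=
  {C of Bimodule_isCoring A C & Bimodule A A C}.

Record coring_morphism (A : pzRingType) (C D : coringType A) (f : C -> D) :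
    Prop := CoringMorphism {
  coring_morphism_left : left_linear f;
  coring_morphism_right : right_linear f;
  coring_morphism_comul : forall c, comul (f c) = tmap f f (comul c);
  coring_morphism_counit : forall c, counit (f c) = counit c }.

Definition coring_isomorphism (A : pzRingType) (C D : coringType A)
    (f : C -> D) : Prop :=
  coring_morphism f /\ bijective f.

HB.mixin Record RightModule_isComodule (A : pzRingType) (C : coringType A) M
    of RightModule A M := {
  comod_unit : forall m : M, m ◁ (1 : A) = m;
  coact : M -> M ⊗[A] C;
  coact_right : right_linear coact;
  coactA : forall m, tassoc (tmap coact id (coact m)) = tmap id comul (coact m);
  coact_counit : forall m, tlift (fun m0 m1 => m0 ◁ counit m1) (coact m) = m }.

#[short(type="comodType")]
HB.structure Definition Comodule (A : pzRingType) (C : coringType A) :=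
  {M of RightModule_isComodule A C M & RightModule A M}.

(* The objects of the category of firm left R-modules, right C-comodules. *)
HB.mixin Record Bimodule_isFirmComodule (R : rngType) (A : pzRingType)
    (C : coringType A) M of Comodule A C M & Bimodule R A M := {
  firm_comod_firm : left_firm M;
  coact_left : forall (r : R) (m : M), coact (r ▷ m) = r ▷ (coact m) }.

#[short(type="firmComodType")]
HB.structure Definition FirmComodule (R : rngType) (A : pzRingType)
    (C : coringType A) :=
  {M of Bimodule_isFirmComodule R A C M & Comodule A C M & Bimodule R A M}.

Record firm_projectivity (R : rngType) (A : pzRingType) (U : bimodType R A) :=
  FirmProjectivity {
    fp_unit : forall u : U, u ◁ (1 : A) = u;
    fp_iota : R -> U ⊗[A] 'Hom_[A](U, A^reg);
    fp_iotaD : {morph fp_iota : r s / r + s};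
    fp_iotaM : {morph fp_iota : r s / rmul r s};
    fp_iota_act : forall r u, finite_rank_eval (fp_iota r) u = r ▷ u;
    fp_firm : left_firm U }.

Definition firmly_projective (R : rngType) (A : pzRingType)
    (U : bimodType R A) : Prop := inhabited (firm_projectivity U).

(* The comatrix coring U^* ⊗_R U. Its comultiplication sends f ⊗ u to
   f ⊗ e_r ⊗ f_r ⊗ u^r, where r ⊗ u^r = firm_split u and
   e_r ⊗ f_r = fp_iota P r. *)
Section Comatrix.
Variables (R : rngType) (A : pzRingType) (U : bimodType R A).
Variable P : firm_projectivity U.

Notation dual := 'Hom_[A](U, A^reg).

Local Notation comatrix := (dual ⊗[R] U).

Notation iota := (fp_iota P).

Definition comatrix_comul_aux (f : dual) (u : U) (t : U ⊗[A] dual) :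
    comatrix ⊗[A] comatrix :=
  tlift (fun (e : U) (g : dual) =>
           (f ⊗ e : comatrix) ⊗ (g ⊗ u : comatrix)) t.

Definition comatrix_comul : comatrix -> comatrix ⊗[A] comatrix :=
  tlift (fun (f : dual) (u : U) =>
    tlift (fun (r : R^reg) (v : U) => comatrix_comul_aux f v (iota r))
      (firm_split u)).

Definition comatrix_counit : comatrix -> A^reg :=
  tlift (fun (f : dual) (u : U) => f u).

Local Notation H1 := comatrix_comul_aux.

Lemma comul_aux_balanced f u :
  balanced (fun (e : U) (g : dual) =>
    (f ⊗ e : comatrix) ⊗ (g ⊗ u : comatrix) : comatrix ⊗[A] comatrix).
Proof.
by split=> *; rewrite ?(tensDr, tensDl) // -ract_tens tensA lact_tens.
Qed.

Lemma comul_aux_tens f u e g :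
  H1 f u (e ⊗ g) = (f ⊗ e : comatrix) ⊗ (g ⊗ u : comatrix).
Proof. exact: tlift_tens (comul_aux_balanced f u) e g. Qed.

Lemma comul_auxD f u : {morph H1 f u : s t / s + t}.
Proof. exact: tliftD (comul_aux_balanced f u). Qed.

Lemma comul_auxDl f g u t : H1 (f + g) u t = H1 f u t + H1 g u t.
Proof.
move: t; apply: tensor_ext => [s t|s t|e h]; rewrite ?comul_auxD 1?addrACA //.
by rewrite !comul_aux_tens !tensDl.
Qed.

Lemma comul_auxDr f u v t : H1 f (u + v) t = H1 f u t + H1 f v t.
Proof.
move: t; apply: tensor_ext => [s t|s t|e h]; rewrite ?comul_auxD 1?addrACA //.
by rewrite !comul_aux_tens !tensDr.
Qed.

Lemma comul_aux_lact (f : dual) (u : U) (r : R) (t : U ⊗[A] dual) : H1 f u (r ▷ t) = H1 (f ◁ r) u t.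
Proof.
move: t; apply: tensor_ext => [s t|s t|e h]; rewrite ?comul_auxD ?lactDr ?comul_auxD //.
by rewrite lact_tens !comul_aux_tens tensA.
Qed.

Lemma comul_aux_ract (f : dual) (u : U) (r : R) (t : U ⊗[A] dual) : H1 f u (t ◁ r) = H1 f (r ▷ u) t.
Proof.
move: t; apply: tensor_ext => [s t|s t|e h]; rewrite ?comul_auxD ?ractDl ?comul_auxD //.
by rewrite ract_tens !comul_aux_tens tensA.
Qed.

Lemma comul_auxZl (a : A) (f : dual) (u : U) (t : U ⊗[A] dual) : H1 (a ▷ f) u t = a ▷ H1 f u t.
Proof.
move: t; apply: tensor_ext => [s t|s t|e h]; rewrite ?comul_auxD ?lactDr ?comul_auxD //.
by rewrite !comul_aux_tens !lact_tens.
Qed.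

Lemma comul_auxZr (a : A) (f : dual) (u : U) (t : U ⊗[A] dual) : H1 f (u ◁ a) t = H1 f u t ◁ a.
Proof.
move: t; apply: tensor_ext => [s t|s t|e h]; rewrite ?comul_auxD ?ractDl ?comul_auxD //.
by rewrite !comul_aux_tens !ract_tens.
Qed.

Lemma iotaMr r s : iota (rmul r s) = r ▷ iota s.
Proof.
rewrite (fp_iotaM P); move: (iota s).
apply: tensor_ext => [t t'|t t'|u f]; first exact: rmulDr.
  exact: lactDr.
by rewrite lact_tens -(fp_iota_act P); exact: finite_rank_mul_tens.
Qed.

Definition dual_comp (f : dual) : U ⊗[A] dual -> dual :=
  tlift (fun (u : U) (g : dual) => f u ▷ g).

Lemma dual_comp_balanced (f : dual) :
  balanced (fun (u : U) (g : dual) => f u ▷ g : dual).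
Proof.
split=> [u v g|u g h|u a g]; rewrite ?rhomD ?lactDl ?lactDr //.
by rewrite rhom_ract lactA.
Qed.

Lemma dual_comp_tens f u g : dual_comp f (u ⊗ g) = f u ▷ g.
Proof. exact: tlift_tens (dual_comp_balanced f) u g. Qed.

Lemma dual_compD f : {morph dual_comp f : s t / s + t}.
Proof. exact: tliftD (dual_comp_balanced f). Qed.

Lemma dual_compE f t u : dual_comp f t u = f (finite_rank_eval t u).
Proof.
move: t; apply: tensor_ext => [s t|s t|v g].
- by rewrite dual_compD.
- by rewrite finite_rank_evalDl rhomD.
- by rewrite dual_comp_tens finite_rank_evalE rhom_ract.
Qed.

Lemma dual_comp_iota f r : dual_comp f (iota r) = f ◁ r.
Proof. by apply: rhomP => u; rewrite dual_compE fp_iota_act. Qed.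

Lemma iotaMl r s : iota (rmul r s) = iota r ◁ s.
Proof.
rewrite (fp_iotaM P); move: (iota r).
apply: tensor_ext => [t t'|t t'|u f]; first by move=> *; exact: rmulDl.
  exact: ractDl.
rewrite ract_tens -dual_comp_iota; move: (iota s).
apply: tensor_ext => [t t'|t t'|v g]; first exact: rmulDr.
  by rewrite dual_compD tensDr.
by rewrite dual_comp_tens -tensA; exact: finite_rank_mulE.
Qed.

Lemma comatrix_comul_inner_balanced f :
  balanced (fun (r : R^reg) (v : U) => H1 f v (iota r)).
Proof.
split=> [r s v|r v w|r s v]; first by rewrite (fp_iotaD P) comul_auxD.
  exact: comul_auxDr.
by rewrite -comul_aux_ract -iotaMl.
Qed.

Definition comatrix_comul_fun f u :=
  tlift (fun (r : R^reg) (v : U) => H1 f v (iota r)) (firm_split u).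

Lemma comul_fun_act f r u : comatrix_comul_fun f (r ▷ u) = H1 f u (iota r).
Proof.
rewrite /comatrix_comul_fun (firm_split_act (fp_firm P)).
exact: (tlift_tens (comatrix_comul_inner_balanced f)).
Qed.

Lemma comul_funD f : {morph comatrix_comul_fun f : u v / u + v}.
Proof.
move=> u v; rewrite /comatrix_comul_fun (firm_splitD (fp_firm P)).
exact: (tliftD (comatrix_comul_inner_balanced f)).
Qed.

Lemma comatrix_comul_balanced :
  balanced (fun (f : dual) (u : U) => comatrix_comul_fun f u).
Proof.
split=> [f g u|f u v|f r u]; last 2 first.
- exact: comul_funD.
- move: u; apply: (firm_ext (fp_firm P)) => [u v|u v|s u].
  + exact: comul_funD.
  + by rewrite lactDr comul_funD.
  + by rewrite lactA !comul_fun_act iotaMr comul_aux_lact.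
move: u; apply: (firm_ext (fp_firm P)) => [u v|u v|s u].
- exact: comul_funD.
- by rewrite !comul_funD addrACA.
- by rewrite !comul_fun_act comul_auxDl.
Qed.

Lemma comatrix_comulD : {morph comatrix_comul : c d / c + d}.
Proof. exact: tliftD comatrix_comul_balanced. Qed.

Lemma comatrix_comul_tens f r u :
  comatrix_comul (f ⊗ (r ▷ u)) = H1 f u (iota r).
Proof.
rewrite -comul_fun_act; exact: (tlift_tens comatrix_comul_balanced).
Qed.

Lemma comatrix_ext (G : zmodType) (h k : comatrix -> G) :
  {morph h : c d / c + d} -> {morph k : c d / c + d} ->
  (forall f r u, h (f ⊗ (r ▷ u)) = k (f ⊗ (r ▷ u))) -> h =1 k.
Proof.
move=> hD kD hk; apply: tensor_ext => // f.
apply: (firm_ext (fp_firm P)) => [u v|u v|r u]; last exact: hk.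
  by rewrite tensDr hD.
by rewrite tensDr kD.
Qed.

Lemma comatrix_comul_left : left_linear comatrix_comul.
Proof.
split=> [|a]; first exact: comatrix_comulD.
apply: comatrix_ext => [c d|c d|f r u].
- by rewrite lactDr comatrix_comulD.
- by rewrite comatrix_comulD lactDr.
- by rewrite lact_tens !comatrix_comul_tens comul_auxZl.
Qed.

Lemma comatrix_comul_right : right_linear comatrix_comul.
Proof.
split=> [|c a]; first exact: comatrix_comulD.
move: c; apply: comatrix_ext => [c d|c d|f r u].
- by rewrite ractDl comatrix_comulD.
- by rewrite comatrix_comulD ractDl.
- by rewrite ract_tens lractA !comatrix_comul_tens comul_auxZr.
Qed.

Lemma comatrix_counit_balanced :
  balanced (fun (f : dual) (u : U) => f u).
Proof. by split=> // f u v; rewrite rhomD. Qed.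

Lemma comatrix_counitD : {morph comatrix_counit : c d / c + d}.
Proof. exact: tliftD comatrix_counit_balanced. Qed.

Lemma comatrix_counit_tens f u : comatrix_counit (f ⊗ u) = f u.
Proof. exact: tlift_tens comatrix_counit_balanced f u. Qed.

Lemma comatrix_counit_left : left_linear comatrix_counit.
Proof.
split=> [|a]; first exact: comatrix_counitD.
apply: tensor_ext => [c d|c d|f u].
- by rewrite lactDr comatrix_counitD.
- by rewrite comatrix_counitD lactDr.
- by rewrite lact_tens !comatrix_counit_tens.
Qed.

Lemma comatrix_counit_right : right_linear comatrix_counit.
Proof.
split=> [|c a]; first exact: comatrix_counitD.
move: c; apply: tensor_ext => [c d|c d|f u].
- by rewrite ractDl comatrix_counitD.
- by rewrite comatrix_counitD ractDl.
- by rewrite ract_tens !comatrix_counit_tens rhom_ract.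
Qed.

Lemma comatrix_unitl (c : comatrix) : (1 : A) ▷ c = c.
Proof.
move: c; apply: tensor_ext => [c d|//|f u]; first exact: lactDr.
rewrite lact_tens; congr (_ ⊗ _); apply: rhomP => v; exact: mul1r.
Qed.

Lemma comatrix_unitr (c : comatrix) : c ◁ (1 : A) = c.
Proof.
move: c; apply: tensor_ext => [c d|//|f u]; first exact: ractDl.
by rewrite ract_tens (fp_unit P).
Qed.

Definition comul3 (f : dual) (u : U) (t s : U ⊗[A] dual) :
    comatrix ⊗[A] (comatrix ⊗[A] comatrix) :=
  tlift (fun (e : U) (g : dual) => (f ⊗ e : comatrix) ⊗ H1 g u t) s.

Lemma comul3_balanced f u t :
  balanced (fun (e : U) (g : dual) => (f ⊗ e : comatrix) ⊗ H1 g u t :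
    comatrix ⊗[A] (comatrix ⊗[A] comatrix)).
Proof.
split=> [e e' g|e g h|e a g]; first by rewrite !tensDr tensDl.
  by rewrite comul_auxDl tensDr.
by rewrite -ract_tens tensA comul_auxZl.
Qed.

Lemma comul3_tens f u t e g :
  comul3 f u t (e ⊗ g) = (f ⊗ e : comatrix) ⊗ H1 g u t.
Proof. exact: tlift_tens (comul3_balanced f u t) e g. Qed.

Lemma comul3Dr f u t : {morph comul3 f u t : s s' / s + s'}.
Proof. exact: tliftD (comul3_balanced f u t). Qed.

Lemma comul3Dl f u s : {morph comul3 f u ^~ s : t t' / t + t'}.
Proof.
move=> t t'; move: s; apply: tensor_ext => [s s'|s s'|e g].
- by rewrite comul3Dr.
- by rewrite !comul3Dr addrACA.
- by rewrite !comul3_tens comul_auxD tensDr.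
Qed.

Lemma comatrix_comulA (c : comatrix) :
  tassoc (tmap comatrix_comul id (comatrix_comul c)) =
    tmap id comatrix_comul (comatrix_comul c).
Proof.
have rI := @id_right_linear A comatrix; have lI := @id_left_linear A comatrix.
have lD := tmapD comatrix_comul_right lI.
have rD := tmapD rI comatrix_comul_left.
have lE := tmap_tens comatrix_comul_right lI.
have rE := tmap_tens rI comatrix_comul_left.
move: c; apply: comatrix_ext => [c d|c d|f r u].
- by rewrite comatrix_comulD lD tassocD.
- by rewrite comatrix_comulD rD.
rewrite comatrix_comul_tens.
move: u; apply: (firm_ext (fp_firm P)) => [u v|u v|s u].
- by rewrite comul_auxDr lD tassocD.
- by rewrite comul_auxDr rD.
have -> : tmap id comatrix_comul (H1 f (s ▷ u) (iota r)) =
    comul3 f u (iota s) (iota r).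
  move: (iota r); apply: tensor_ext => [t t'|t t'|e g].
  - by rewrite comul_auxD rD.
  - exact: comul3Dr.
  - by rewrite comul_aux_tens rE comul3_tens comatrix_comul_tens.
rewrite -comul_aux_ract -iotaMl iotaMr comul_aux_lact; move: (iota s).
apply: tensor_ext => [t t'|t t'|e g].
- by rewrite comul_auxD lD tassocD.
- exact: comul3Dl.
rewrite comul_aux_tens lE tensA comatrix_comul_tens; move: (iota r).
apply: tensor_ext => [t t'|t t'|e' g'].
- by rewrite comul_auxD tensDl tassocD.
- exact: comul3Dr.
- by rewrite comul_aux_tens tassoc_tens comul3_tens comul_aux_tens.
Qed.

Lemma comatrix_counitl_balanced :
  balanced (fun c d : comatrix => comatrix_counit c ▷ d).
Proof.
case: comatrix_counit_right => cD cZ.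
split=> [c c' d|c d d'|c a d]; [by rewrite cD lactDl|exact: lactDr|].
by rewrite cZ lactA.
Qed.

Lemma comatrix_counitr_balanced :
  balanced (fun c d : comatrix => c ◁ comatrix_counit d).
Proof.
case: comatrix_counit_left => cD cZ.
split=> [c c' d|c d d'|c a d]; [exact: ractDl|by rewrite cD ractDr|].
by rewrite cZ ractA.
Qed.

Lemma comatrix_comul_counitl (c : comatrix) :
  tlift (fun c1 c2 : comatrix => comatrix_counit c1 ▷ c2) (comatrix_comul c) = c.
Proof.
have bD := tliftD comatrix_counitl_balanced.
have bE := tlift_tens comatrix_counitl_balanced.
move: c; apply: comatrix_ext => [c d|//|f r u].
  by rewrite comatrix_comulD bD.
rewrite comatrix_comul_tens -tensA -dual_comp_iota; move: (iota r).
apply: tensor_ext => [t t'|t t'|e g].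
- by rewrite comul_auxD bD.
- by rewrite dual_compD tensDl.
- by rewrite comul_aux_tens bE comatrix_counit_tens dual_comp_tens lact_tens.
Qed.

Lemma comatrix_comul_counitr (c : comatrix) :
  tlift (fun c1 c2 : comatrix => c1 ◁ comatrix_counit c2) (comatrix_comul c) = c.
Proof.
have bD := tliftD comatrix_counitr_balanced.
have bE := tlift_tens comatrix_counitr_balanced.
move: c; apply: comatrix_ext => [c d|//|f r u].
  by rewrite comatrix_comulD bD.
rewrite comatrix_comul_tens -(fp_iota_act P); move: (iota r).
apply: tensor_ext => [t t'|t t'|e g].
- by rewrite comul_auxD bD.
- by rewrite finite_rank_evalDl tensDr.
- by rewrite comul_aux_tens bE comatrix_counit_tens finite_rank_evalE ract_tens.
Qed.

Definition comatrix_coring_mixin := Bimodule_isCoring.Build A (dual ⊗[R] U)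
  comatrix_unitl comatrix_unitr comatrix_comul_left comatrix_comul_right
  comatrix_counit_left comatrix_counit_right comatrix_comulA
  comatrix_comul_counitl comatrix_comul_counitr.

Definition comatrix_coring : coringType A :=
  HB.pack (dual ⊗[R] U) comatrix_coring_mixin.
End Comatrix.

(* f ⊗ u |-> f(u_[0]) u_[1] *)
Definition can (R : rngType) (A : pzRingType) (C : coringType A)
    (U : firmComodType R C) : 'Hom_[A](U, A^reg) ⊗[R] U -> C :=
  tlift (fun (f : 'Hom_[A](U, A^reg)) (u : U) =>
    tlift (fun (u0 : U) (u1 : C) => f u0 ▷ u1) (coact u)).

Section CanTens.
Variables (R : rngType) (A : pzRingType) (C : coringType A).
Variable U : firmComodType R C.

Lemma can_inner_balanced (f : 'Hom_[A](U, A^reg)) :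
  balanced (fun (u0 : U) (u1 : C) => f u0 ▷ u1).
Proof.
split=> [u v c|u c d|u a c]; [by rewrite rhomD lactDl|exact: lactDr|].
by rewrite rhom_ract lactA.
Qed.

Lemma can_balanced :
  balanced (fun (f : 'Hom_[A](U, A^reg)) (u : U) =>
    tlift (fun (u0 : U) (u1 : C) => f u0 ▷ u1) (coact u)).
Proof.
have bD f := tliftD (can_inner_balanced f).
have bE f := tlift_tens (can_inner_balanced f).
split=> [f g u|f u v|f r u]; last 2 first.
- by rewrite (right_linearD coact_right) bD.
- rewrite coact_left; move: (coact u); apply: tensor_ext => [s t|s t|v c].
  + exact: bD.
  + by rewrite lactDr bD.
  + by rewrite lact_tens !bE.
move: (coact u); apply: tensor_ext => [s t|s t|v c].
- exact: bD.
- by rewrite !bD addrACA.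
- by rewrite !bE lactDl.
Qed.

Lemma can_tens (f : 'Hom_[A](U, A^reg)) (u : U) :
  can (f ⊗ u) = tlift (fun (u0 : U) (u1 : C) => f u0 ▷ u1) (coact u).
Proof. exact: tlift_tens can_balanced f u. Qed.
End CanTens.

(* R acts by C-colinear maps on U by [coact_left]. *)
Definition galois_comodule (R : rngType) (A : pzRingType) (C : coringType A)
    (U : firmComodType R C) : Prop :=
  exists P : firm_projectivity U,
    coring_isomorphism (@can R A C U : comatrix_coring P -> C).

(* f ⊗ u |-> f(u_[0]) ⊗ u_[1] *)
Definition can_at (R : rngType) (A : pzRingType) (C : coringType A)
    (U : firmComodType R C) (M : rightModType A) :
    'Hom_[A](U, M) ⊗[R] U -> M ⊗[A] C :=
  tlift (fun (f : 'Hom_[A](U, M)) (u : U) => tmap f id (coact u)).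

Section CanAtTens.
Variables (R : rngType) (A : pzRingType) (C : coringType A).
Variables (U : firmComodType R C) (M : rightModType A).

Lemma rhom_right_linear (f : 'Hom_[A](U, M)) : right_linear f.
Proof. by split; [exact: rhomD|exact: rhom_ract]. Qed.

Lemma can_at_balanced :
  balanced (fun (f : 'Hom_[A](U, M)) (u : U) => tmap f (@id C) (coact u)).
Proof.
have bD f := tmapD (rhom_right_linear f) (@id_left_linear A C).
have bE f := tmap_tens (rhom_right_linear f) (@id_left_linear A C).
split=> [f g u|f u v|f r u]; last 2 first.
- by rewrite (right_linearD coact_right) bD.
- rewrite coact_left; move: (coact u); apply: tensor_ext => [s t|s t|v c].
  + exact: bD.
  + by rewrite lactDr bD.
  + by rewrite lact_tens !bE.
move: (coact u); apply: tensor_ext => [s t|s t|v c].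
- exact: bD.
- by rewrite !bD addrACA.
- by rewrite !bE tensDl.
Qed.

Lemma can_at_tens (f : 'Hom_[A](U, M)) (u : U) :
  can_at (f ⊗ u) = tmap f (@id C) (coact u).
Proof. exact: tlift_tens can_at_balanced f u. Qed.
End CanAtTens.

Definition comonadic_galois_comodule (R : rngType) (A : pzRingType)
    (C : coringType A) (U : firmComodType R C) : Prop :=
  forall M : rightModType A, (forall m : M, m ◁ (1 : A) = m) ->
    bijective (@can_at R A C U M).

(* Main.v *)
Require Import Defs.
From mathcomp Require Import all_boot ssralg.
From mathcomp Require Import boolp.

(* For every right A-module M the map
     M ⊗_A (Σ^* ⊗_R Σ) -> Hom_A(Σ, M) ⊗_R Σ,   m ⊗ (f ⊗ u) |-> m f(-) ⊗ u
   is bijective, with inverse g ⊗ r u |-> g(e_r) ⊗ (f_r ⊗ u). Composed with can_M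
   it gives M ⊗ can, so can_M is bijective as soon as can is; conversely can_A is
   can up to the identification A ⊗_A C = C. *)

Import GRing.Theory.
Local Open Scope ring_scope.

Set Implicit Arguments.
Unset Strict Implicit.
Unset Printing Implicit Defensive.

(** * Rank-one maps [m f(-)] in Hom_A(U, M) *)

Section RankOne.
Variables (A : pzRingType) (U M : rightModType A).

Program Definition rank_one (m : M) (f : 'Hom_[A](U, A^reg)) : 'Hom_[A](U, M) :=
  @RightHom A U M (fun u => m ◁ f u) _ _.
Next Obligation. by move=> u v; rewrite rhomD ractDr. Qed.
Next Obligation. by rewrite rhom_ract ractA. Qed.

Lemma rank_oneDl m m' f : rank_one (m + m') f = rank_one m f + rank_one m' f.
Proof. by apply: rhomP => u; exact: ractDl. Qed.

Lemma rank_oneDr m f g : rank_one m (f + g) = rank_one m f + rank_one m g.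
Proof. by apply: rhomP => u; exact: ractDr. Qed.

Lemma rank_oneA m a f : rank_one (m ◁ a) f = rank_one m (a ▷ f).
Proof. by apply: rhomP => u; exact: ractA. Qed.
End RankOne.

(** * Comparison of M ⊗_A (U^* ⊗_R U) with Hom_A(U, M) ⊗_R U *)

Section HomTensor.
Variables (R : rngType) (A : pzRingType) (U : bimodType R A).
Variable M : rightModType A.

Notation dual := 'Hom_[A](U, A^reg).
Notation comatrix := (dual ⊗[R] U).
Notation homt := ('Hom_[A](U, M) ⊗[R] U).

Lemma rank_one_ract (m : M) (f : dual) (r : R) :
  rank_one m (f ◁ r) = rank_one m f ◁ r.
Proof. exact: rhomP. Qed.

Definition rank_one_tensor (m : M) : comatrix -> homt :=
  tlift (fun (f : dual) (u : U) => rank_one m f ⊗ u).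

Lemma rank_one_tensor_inner_balanced m :
  balanced (fun (f : dual) (u : U) => rank_one m f ⊗ u : homt).
Proof.
split=> [f g u|f u v|f r u]; first by rewrite rank_oneDr tensDl.
  exact: tensDr.
by rewrite rank_one_ract tensA.
Qed.

Lemma rank_one_tensor_tens m f u : rank_one_tensor m (f ⊗ u) = rank_one m f ⊗ u.
Proof. exact: tlift_tens (rank_one_tensor_inner_balanced m) f u. Qed.

Lemma rank_one_tensorDr m : {morph rank_one_tensor m : c d / c + d}.
Proof. exact: tliftD (rank_one_tensor_inner_balanced m). Qed.

Lemma rank_one_tensor_balanced : balanced rank_one_tensor.
Proof.
split=> [m m' c|m c d|m a c]; last 2 first.
- exact: rank_one_tensorDr.
- move: c; apply: tensor_ext => [c d|c d|f u].
  + exact: rank_one_tensorDr.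
  + by rewrite lactDr rank_one_tensorDr.
  + by rewrite lact_tens !rank_one_tensor_tens rank_oneA.
move: c; apply: tensor_ext => [c d|c d|f u].
- exact: rank_one_tensorDr.
- by rewrite !rank_one_tensorDr addrACA.
- by rewrite !rank_one_tensor_tens rank_oneDl tensDl.
Qed.

Definition tensor_to_hom : M ⊗[A] comatrix -> homt := tlift rank_one_tensor.

Lemma tensor_to_hom_tens m f u :
  tensor_to_hom (m ⊗ (f ⊗ u : comatrix)) = rank_one m f ⊗ u.
Proof.
rewrite /tensor_to_hom (tlift_tens rank_one_tensor_balanced).
exact: rank_one_tensor_tens.
Qed.

Lemma tensor_to_homD : {morph tensor_to_hom : s t / s + t}.
Proof. exact: tliftD rank_one_tensor_balanced. Qed.

(** Here [t] stands for [e_r ⊗ f_r]; it is kept arbitrary so that identities can be checked on pure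
    tensors. *)
Definition hom_contract (g : 'Hom_[A](U, M)) (u : U) :
    U ⊗[A] dual -> M ⊗[A] comatrix :=
  tlift (fun (e : U) (h : dual) => g e ⊗ (h ⊗ u : comatrix)).

Lemma hom_contract_balanced (g : 'Hom_[A](U, M)) (u : U) :
  balanced (fun (e : U) (h : dual) =>
    g e ⊗ (h ⊗ u : comatrix) : M ⊗[A] comatrix).
Proof.
split=> [e e' h|e h h'|e a h]; first by rewrite rhomD tensDl.
  by rewrite !tensDl tensDr.
by rewrite rhom_ract tensA lact_tens.
Qed.

Lemma hom_contract_tens g u e h :
  hom_contract g u (e ⊗ h) = g e ⊗ (h ⊗ u : comatrix).
Proof. exact: tlift_tens (hom_contract_balanced g u) e h. Qed.

Lemma hom_contractD g u : {morph hom_contract g u : s t / s + t}.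
Proof. exact: tliftD (hom_contract_balanced g u). Qed.

Lemma hom_contractDl g g' u t :
  hom_contract (g + g') u t = hom_contract g u t + hom_contract g' u t.
Proof.
move: t; apply: tensor_ext => [s t|s t|e h]; rewrite ?hom_contractD 1?addrACA //.
by rewrite !hom_contract_tens tensDl.
Qed.

Lemma hom_contractDr g u v t :
  hom_contract g (u + v) t = hom_contract g u t + hom_contract g v t.
Proof.
move: t; apply: tensor_ext => [s t|s t|e h]; rewrite ?hom_contractD 1?addrACA //.
by rewrite !hom_contract_tens !tensDr.
Qed.

Lemma hom_contract_ractl (g : 'Hom_[A](U, M)) u (r : R) (t : U ⊗[A] dual) :
  hom_contract (g ◁ r) u t = hom_contract g u (r ▷ t).
Proof.
move: t; apply: tensor_ext => [s t|s t|e h].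
- exact: hom_contractD.
- by rewrite lactDr hom_contractD.
- by rewrite lact_tens !hom_contract_tens.
Qed.

Lemma hom_contract_lactr g u (r : R) (t : U ⊗[A] dual) :
  hom_contract g (r ▷ u) t = hom_contract g u (t ◁ r).
Proof.
move: t; apply: tensor_ext => [s t|s t|e h].
- exact: hom_contractD.
- by rewrite ractDl hom_contractD.
- by rewrite ract_tens !hom_contract_tens -tensA.
Qed.

(** For [t = e ⊗ h] the left side is [g(e) h(-) ⊗ u], and [g(e) h(v) = g(e h(v))] is [g] at the
    action of [t] on [v]. *)
Lemma tensor_to_hom_contract (g : 'Hom_[A](U, M)) u (t : U ⊗[A] dual) (r : R) :
  (forall v, finite_rank_eval t v = r ▷ v) ->
  tensor_to_hom (hom_contract g u t) = (g ◁ r) ⊗ u.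
Proof.
(* [comp t] collects the maps [g(e) h(-)] into a single element of Hom_A(U, M), namely [g] after the
   action of [t]. *)
pose comp t := tlift (fun (e : U) (h : dual) => rank_one (g e) h) t.
have cb : balanced (fun (e : U) (h : dual) => rank_one (g e) h).
  split=> [e e' h|e h h'|e a h]; first by rewrite rhomD rank_oneDl.
    exact: rank_oneDr.
  by rewrite rhom_ract rank_oneA.
have cD : {morph comp : s t / s + t} := tliftD cb.
have compE v : comp t v = g (finite_rank_eval t v).
  move: t; apply: tensor_ext => [s t|s t|e h].
  - by rewrite cD.
  - by rewrite finite_rank_evalDl rhomD.
  - by rewrite /comp (tlift_tens cb) finite_rank_evalE rhom_ract.
move=> tr; have <- : comp t = g ◁ r by apply: rhomP => v; rewrite compE tr.
(* The action of [t] has served to identify [comp t]; what remains holds for every [t], so the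
   hypothesis is dropped before the induction. *)
move: t {compE tr}; apply: tensor_ext => [s t|s t|e h].
- by rewrite hom_contractD tensor_to_homD.
- by rewrite cD tensDl.
- by rewrite hom_contract_tens tensor_to_hom_tens /comp (tlift_tens cb).
Qed.

(** In [m f(e) ⊗ (h ⊗ u)] the scalar [f(e)] crosses to [h], and the [f(e) h] add up to
    [dual_comp f t]. *)
Lemma hom_contract_rank_one m f u (t : U ⊗[A] dual) :
  hom_contract (rank_one m f) u t = m ⊗ (dual_comp f t ⊗ u : comatrix).
Proof.
move: t; apply: tensor_ext => [s t|s t|e h].
- exact: hom_contractD.
- by rewrite dual_compD tensDl tensDr.
- by rewrite hom_contract_tens dual_comp_tens -lact_tens -tensA.
Qed.

(** * The inverse map, built from [fp_iota P] and firmness of [U] *)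

Variable P : firm_projectivity U.

Definition hom_to_tensor_fun (g : 'Hom_[A](U, M)) (u : U) : M ⊗[A] comatrix :=
  tlift (fun (r : R^reg) (v : U) => hom_contract g v (fp_iota P r)) (firm_split u).

(** Multiplicativity of [fp_iota P] enters as right R-linearity, [iotaMl]. *)
Lemma hom_to_tensor_inner_balanced g :
  balanced (fun (r : R^reg) (v : U) => hom_contract g v (fp_iota P r)).
Proof.
split=> [r s v|r v w|r s v]; first by rewrite (fp_iotaD P) hom_contractD.
  exact: hom_contractDr.
by rewrite hom_contract_lactr -iotaMl.
Qed.

Lemma hom_to_tensor_fun_act g r u :
  hom_to_tensor_fun g (r ▷ u) = hom_contract g u (fp_iota P r).
Proof.
rewrite /hom_to_tensor_fun (firm_split_act (fp_firm P)).
exact: (tlift_tens (hom_to_tensor_inner_balanced g)).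
Qed.

Lemma hom_to_tensor_funD g : {morph hom_to_tensor_fun g : u v / u + v}.
Proof.
move=> u v; rewrite /hom_to_tensor_fun (firm_splitD (fp_firm P)).
exact: (tliftD (hom_to_tensor_inner_balanced g)).
Qed.

(** By firmness it is enough to test vectors [s ▷ u]; there balance over [R] is left R-linearity of
    [fp_iota P], [iotaMr]. *)
Lemma hom_to_tensor_balanced : balanced hom_to_tensor_fun.
Proof.
split=> [g h u|g u v|g r u]; last 2 first.
- exact: hom_to_tensor_funD.
- move: u; apply: (firm_ext (fp_firm P)) => [u v|u v|s u].
  + exact: hom_to_tensor_funD.
  + by rewrite lactDr hom_to_tensor_funD.
  + by rewrite lactA !hom_to_tensor_fun_act iotaMr hom_contract_ractl.
move: u; apply: (firm_ext (fp_firm P)) => [u v|u v|s u].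
- exact: hom_to_tensor_funD.
- by rewrite !hom_to_tensor_funD addrACA.
- by rewrite !hom_to_tensor_fun_act hom_contractDl.
Qed.

Definition hom_to_tensor : homt -> M ⊗[A] comatrix := tlift hom_to_tensor_fun.

Lemma hom_to_tensorD : {morph hom_to_tensor : s t / s + t}.
Proof. exact: tliftD hom_to_tensor_balanced. Qed.

Lemma hom_to_tensor_tens g r u :
  hom_to_tensor (g ⊗ (r ▷ u)) = hom_contract g u (fp_iota P r).
Proof.
rewrite -hom_to_tensor_fun_act; exact: (tlift_tens hom_to_tensor_balanced).
Qed.

(** The round trip sends [m ⊗ (f ⊗ r u)] to [m ⊗ (f(e_r) f_r ⊗ u)]. Since [f(e_r) f_r = f ◁ r],
    moving [r] back across the tensor sign gives the initial element. *)
Lemma tensor_to_homK : cancel tensor_to_hom hom_to_tensor.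
Proof.
apply: tensor_ext => [s t|//|m c].
  by rewrite tensor_to_homD hom_to_tensorD.
move: c; apply: (comatrix_ext P) => [c d|c d|f r u].
- by rewrite tensDr tensor_to_homD hom_to_tensorD.
- exact: tensDr.
rewrite tensor_to_hom_tens hom_to_tensor_tens hom_contract_rank_one.
by rewrite dual_comp_iota tensA.
Qed.

(** The round trip sends [g ⊗ r u] to [g(e_r) f_r(-) ⊗ u], which is [(g ◁ r) ⊗ u] because
    [fp_iota P r] acts on [U] as [r]. *)
Lemma hom_to_tensorK : cancel hom_to_tensor tensor_to_hom.
Proof.
apply: tensor_ext => [s t|//|g].
  by rewrite hom_to_tensorD tensor_to_homD.
apply: (firm_ext (fp_firm P)) => [u v|u v|r u].
- by rewrite tensDr hom_to_tensorD tensor_to_homD.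
- exact: tensDr.
rewrite hom_to_tensor_tens -tensA.
by apply: tensor_to_hom_contract => v; exact: fp_iota_act.
Qed.
End HomTensor.

(** * Tensoring a linear bijection with a module *)

Section TensorMapBijective.
Variables (R : rngType) (M : rightModType R) (N N' : leftModType R).

Lemma tmap_id_bij (g : N -> N') :
  left_linear g -> bijective g -> bijective (tmap (@id M) g).
Proof.
move=> gl [g' gK g'K]; have gI := can_inj gK; have [gD gZ] := gl.
(* Linearity of the inverse is what makes [tmap id g'] compute on pure tensors. *)
have g'l : left_linear g'.
  by split=> [x y|r x]; apply: gI; rewrite ?gD ?gZ !g'K.
have idl := @id_right_linear R M.
exists (tmap id g'); apply: tensor_ext => [s t|//|m n].
- by rewrite (tmapD idl gl) (tmapD idl g'l).
- by rewrite (tmap_tens idl gl) (tmap_tens idl g'l) gK.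
- by rewrite (tmapD idl g'l) (tmapD idl gl).
- by rewrite (tmap_tens idl g'l) (tmap_tens idl gl) g'K.
Qed.
End TensorMapBijective.

(** * The identification A ⊗_A N = N for unital N *)

Section RegularTensor.
Variables (A : pzRingType) (N : leftModType A).

Lemma firm_act_bij_of_unital :
  (forall n : N, (1 : A) ▷ n = n) -> bijective (@firm_act A N).
Proof.
move=> N1; exists (fun n => (1 : A^reg) ⊗ n) => [|n]; last first.
  by rewrite firm_act_tens.
apply: tensor_ext => [s t|//|a n]; first by rewrite firm_actD tensDr.
rewrite firm_act_tens -tensA; congr (_ ⊗ _); exact: mul1r.
Qed.
End RegularTensor.

(** * Bilinearity of [can] and its compatibility with the counits *)

Section Can.
Variables (R : rngType) (A : pzRingType) (C : coringType A).
Variable U : firmComodType R C.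

Notation dual := 'Hom_[A](U, A^reg).
Notation comatrix := (dual ⊗[R] U).
Local Notation can := (@can R A C U).

Lemma canD : {morph can : c d / c + d}.
Proof. exact: tliftD (@can_balanced R A C U). Qed.

Lemma can_at_D (M : rightModType A) : {morph @can_at R A C U M : s t / s + t}.
Proof. exact: tliftD (@can_at_balanced R A C U M). Qed.

(** This is [f ⊗ C] followed by A ⊗_A C = C. It isolates the part of [can] applied after the
    coaction, so that [coact u] can be generalized to any tensor. *)
Definition slice (f : dual) : U ⊗[A] C -> C :=
  tlift (fun (u0 : U) (u1 : C) => f u0 ▷ u1).

Lemma slice_tens f u c : slice f (u ⊗ c) = f u ▷ c.
Proof. exact: tlift_tens (can_inner_balanced f) u c. Qed.

Lemma sliceD f : {morph slice f : s t / s + t}.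
Proof. exact: tliftD (can_inner_balanced f). Qed.

Lemma slice_left (f : dual) (a : A) (t : U ⊗[A] C) :
  slice (a ▷ f) t = a ▷ slice f t.
Proof.
move: t; apply: tensor_ext => [s t|s t|u c].
- exact: sliceD.
- by rewrite sliceD lactDr.
- by rewrite !slice_tens lactA.
Qed.

Lemma slice_right (f : dual) : right_linear (slice f).
Proof.
split=> [|t a]; first exact: sliceD.
move: t; apply: tensor_ext => [s t|s t|u c].
- by rewrite ractDl sliceD.
- by rewrite sliceD ractDl.
- by rewrite ract_tens !slice_tens lractA.
Qed.

Lemma can_slice f u : can (f ⊗ u) = slice f (coact u).
Proof. exact: can_tens. Qed.

Lemma can_left : left_linear (can).
Proof.
split=> [|a]; first exact: canD.
apply: tensor_ext => [c d|c d|f u].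
- by rewrite lactDr canD.
- by rewrite canD lactDr.
- by rewrite lact_tens !can_slice slice_left.
Qed.

Lemma can_right : right_linear (can).
Proof.
split=> [|c a]; first exact: canD.
move: c; apply: tensor_ext => [c d|c d|f u].
- by rewrite ractDl canD.
- by rewrite canD ractDl.
rewrite ract_tens !can_slice (right_linearZ coact_right).
exact: right_linearZ (slice_right f) _ _.
Qed.

Lemma counit_can c : counit (can c) = comatrix_counit c.
Proof.
have [eD eZ] := @counit_left A C.
move: c; apply: tensor_ext => [c d|c d|f u].
- by rewrite canD eD.
- exact: comatrix_counitD.
(* Expanding the argument of [f] as [u_[0] ε(u_[1])] makes both sides functions of [coact u]; they
   agree since [ε] and [f] are A-linear. *)
rewrite can_slice comatrix_counit_tens -{2}(coact_counit u).
have cb : balanced (fun (m : U) (c : C) => m ◁ counit c).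
  split=> [m m' c|m c d|m a c]; first exact: ractDl.
    by rewrite eD ractDr.
  by rewrite eZ ractA.
move: (coact u); apply: tensor_ext => [s t|s t|v c].
- by rewrite sliceD eD.
- by rewrite (tliftD cb) rhomD.
- by rewrite slice_tens (tlift_tens cb) eZ rhom_ract.
Qed.

(** * Compatibility of [can] with the comultiplications *)

Lemma can_tens_right (f : dual) : right_linear (fun u : U => can (f ⊗ u)).
Proof.
split=> [u v|u a]; first by rewrite tensDr canD.
by rewrite -ract_tens (right_linearZ can_right).
Qed.

(** The map [can (f ⊗ -)] is C-colinear by coassociativity: both sides are [f(u_[0]) u_[1] ⊗
    u_[2]]. *)
Lemma comul_can_tens (f : dual) (u : U) :
  comul (can (f ⊗ u)) = tmap (fun v : U => can (f ⊗ v)) id (coact u).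
Proof.
have [dD dZ] := @comul_left A C; have idl := @id_left_linear A C.
have rcoact := @coact_right A C U; have idr := @id_right_linear A U.
have cr := can_tens_right f.
(* The analogue of [slice f] with values in C ⊗_A C, to be applied to both sides of
   coassociativity. *)
pose slice2 : U ⊗[A] (C ⊗[A] C) -> C ⊗[A] C := tlift (fun v t => f v ▷ t).
have sb : balanced (fun (v : U) (t : C ⊗[A] C) => f v ▷ t).
  split=> [v w t|v s t|v a t]; first by rewrite rhomD lactDl.
    exact: lactDr.
  by rewrite rhom_ract lactA.
have sD : {morph slice2 : s t / s + t} := tliftD sb.
have sE v t : slice2 (v ⊗ t) = f v ▷ t := tlift_tens sb v t.
have -> : comul (can (f ⊗ u)) = slice2 (tmap id comul (coact u)).
  rewrite can_slice; move: (coact u); apply: tensor_ext => [s t|s t|v c].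
  - by rewrite sliceD dD.
  - by rewrite (tmapD idr (@comul_left A C)) sD.
  - by rewrite slice_tens (tmap_tens idr (@comul_left A C)) sE dZ.
rewrite -coactA; move: (coact u); apply: tensor_ext => [s t|s t|v c].
- by rewrite (tmapD rcoact idl) tassocD sD.
- exact: tmapD cr idl _ _.
rewrite (tmap_tens rcoact idl) (tmap_tens cr idl) can_slice.
move: (coact v); apply: tensor_ext => [s t|s t|w d].
- by rewrite tensDl tassocD sD.
- by rewrite sliceD tensDl.
- by rewrite tassoc_tens sE slice_tens lact_tens.
Qed.

(* f(e_[0]) e_[1] ⊗ h(v) c = f((e h(v))_[0]) (e h(v))_[1] ⊗ c, for t = e ⊗ h *)
Lemma can_can_comul_aux (f : dual) (u : U) (t : U ⊗[A] dual) :
  tmap can can (comatrix_comul_aux f u t) =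
    tmap (fun v : U => can (f ⊗ finite_rank_eval t v)) id (coact u).
Proof.
have idl := @id_left_linear A C.
have ccD := tmapD can_right can_left.
have ccE := tmap_tens can_right can_left.
have er s : right_linear (fun v : U => can (f ⊗ finite_rank_eval s v)).
  split=> [x y|x a]; first by rewrite finite_rank_evalDr tensDr canD.
  by rewrite finite_rank_evalZ -ract_tens (right_linearZ can_right).
move: t; apply: tensor_ext => [s t|s t|e h].
- by rewrite comul_auxD ccD.
- move: (coact u); apply: tensor_ext => [x y|x y|v c].
  + exact: tmapD (er _) idl _ _.
  + by rewrite !(tmapD (er _) idl) addrACA.
  + by rewrite !(tmap_tens (er _) idl) finite_rank_evalDl tensDr canD tensDl.
rewrite comul_aux_tens ccE (can_slice h).
move: (coact u); apply: tensor_ext => [x y|x y|v c].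
- by rewrite sliceD tensDr.
- exact: tmapD (er _) idl _ _.
rewrite slice_tens (tmap_tens (er _) idl) finite_rank_evalE -tensA.
by rewrite -ract_tens (right_linearZ can_right).
Qed.

(** At [f ⊗ r u] both sides are [can (f ⊗ r u_[0]) ⊗ u_[1]]: on the left because the coaction is
    R-linear, on the right because [fp_iota P r] acts as [r]. *)
Lemma comul_can (P : firm_projectivity U) c :
  comul (can c) = tmap can can (comatrix_comul P c).
Proof.
have idl := @id_left_linear A C; have comulD := left_linearD (@comul_left A C).
move: c; apply: (comatrix_ext P) => [c d|c d|f r u].
- by rewrite canD comulD.
- by rewrite comatrix_comulD (tmapD can_right can_left).
rewrite comul_can_tens coact_left comatrix_comul_tens can_can_comul_aux.
under [in RHS]eq_fun do rewrite fp_iota_act.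
have cr := can_tens_right f.
have cra : right_linear (fun v : U => can (f ⊗ (r ▷ v))).
  split=> [x y|x a]; first by rewrite lactDr tensDr canD.
  by rewrite -lractA -ract_tens (right_linearZ can_right).
move: (coact u); apply: tensor_ext => [s t|s t|v c].
- by rewrite lactDr (tmapD cr idl).
- exact: tmapD cra idl _ _.
- by rewrite lact_tens (tmap_tens cr idl) (tmap_tens cra idl).
Qed.

Lemma can_coring_morphism (P : firm_projectivity U) :
  coring_morphism (can : comatrix_coring P -> C).
Proof.
split; [exact: can_left|exact: can_right|exact: comul_can|exact: counit_can].
Qed.

(** * Comparison of [can_at] with [can] *)

(** Both sides send [m ⊗ (f ⊗ u)] to [m f(u_[0]) ⊗ u_[1] = m ⊗ f(u_[0]) u_[1]]. *)
Lemma can_at_tensor_to_hom (M : rightModType A) (t : M ⊗[A] comatrix) :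
  @can_at R A C U M (tensor_to_hom t) = tmap (@id M) (can) t.
Proof.
have idr := @id_right_linear A M; have idl := @id_left_linear A C.
move: t; apply: tensor_ext => [s t|s t|m c].
- by rewrite tensor_to_homD can_at_D.
- exact: tmapD idr can_left _ _.
rewrite (tmap_tens idr can_left).
move: c; apply: tensor_ext => [c d|c d|f u].
- by rewrite tensDr tensor_to_homD can_at_D.
- by rewrite canD tensDr.
rewrite tensor_to_hom_tens can_at_tens can_slice.
have rr := rhom_right_linear (rank_one m f).
move: (coact u); apply: tensor_ext => [x y|x y|v c].
- exact: tmapD rr idl _ _.
- by rewrite sliceD tensDr.
- by rewrite (tmap_tens rr idl) slice_tens -tensA.
Qed.

Lemma firm_act_can_at (t : comatrix) :
  firm_act (@can_at R A C U A^reg t : A^reg ⊗[A] C) = can t.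
Proof.
have idl := @id_left_linear A C.
move: t; apply: tensor_ext => [s t|s t|f u].
- by rewrite can_at_D firm_actD.
- exact: canD.
rewrite can_at_tens can_slice; have rr := rhom_right_linear f.
move: (coact u); apply: tensor_ext => [x y|x y|v c].
- by rewrite (tmapD rr idl) firm_actD.
- exact: sliceD.
- by rewrite (tmap_tens rr idl) firm_act_tens slice_tens.
Qed.
End Can.

(** * The equivalence of the two Galois conditions *)

Theorem theorem4p2 (A : pzRingType) (C : coringType A) (R : rngType)
    (Sigma : firmComodType R C) :
  firm_ring R -> firmly_projective Sigma ->
  galois_comodule Sigma <-> comonadic_galois_comodule Sigma.
Proof.
move=> _ [P]; split=> [[P' [_ can_bij]] M _|can_at_bij].
  (* As a function [can] is the same for every choice of projectivity data, so its bijectivity,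
     obtained with [P'], combines with the isomorphism built from [P]. *)
  have thK := tensor_to_homK P (M := M); have htK := hom_to_tensorK P (M := M).
  (* [can_at] is [M ⊗ can] after [hom_to_tensor]. *)
  apply: (eq_bij (bij_comp (tmap_id_bij M (can_left Sigma) can_bij)
    (Bijective htK thK))) => t.
  by rewrite /= -can_at_tensor_to_hom htK.
exists P; split; first exact: can_coring_morphism.
(* [can] is [can_at] for M = A followed by the action map A ⊗_A C -> C, a bijection since C is
   unital. *)
apply: eq_bij (@firm_act_can_at R A C Sigma).
apply: bij_comp (firm_act_bij_of_unital (@coring_unitl A C)) _.
by apply: can_at_bij => a; exact: mulr1.
Qed.
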